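(* Every countable odd involutive FL$_e$-chain $\mathbf X$ can be embedded into a countable dense odd involutive FL$_e$-chain $\mathbf Y$. Likewise, every countable idempotent-symmetric odd involutive FL$_e$-chain $\mathbf X$ can be embedded into a countable dense idempotent-symmetric odd involutive FL$_e$-chain $\mathbf Y$.
   Context: An FL$_e$-algebra is a structure $\mathbf X=(X,\leq,\cdot,\rightarrow,t,f)$ such that $(X,\leq)$ is a lattice, $(X,\leq,\cdot,t)$ is a commutative residuated monoid with residual $\rightarrow$ (i.e. $xy\leq z\iff x\rightarrow z\geq y$), and $f$ is an arbitrary constant. The residual complement is $x'=x\rightarrow f$; the algebra is involutive if $(x')'=x$ for all $x$. An involutive FL$_e$-algebra is odd if $t'=t$ (equivalently $f=t$). A chain is a totally ordered algebra. It is idempotent-symmetric if for every element $x$, $x$ is idempotent ($xx=x$) if and only if $x'$ is idempotent. Embeddings are injective FL$_e$-algebra homomorphisms (preserving lattice operations, $\cdot$, $\rightarrow$, $t$, $f$). A chain is dense if it has at least two elements and for any two elements $a<b$ there is $c$ with $a<c<b$. *)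

(* Defs.v *)
From HB Require Import structures.
From mathcomp Require Import all_boot all_order.
From mathcomp Require Import classical_sets cardinality.

Set Implicit Arguments.
Unset Strict Implicit.
Unset Printing Implicit Defensive.

Local Open Scope order_scope.
Local Open Scope group_scope.

(* The monoid unit [1] is the constant t; [flef] is the constant f. *)
HB.mixin Record Lattice_isFLe (d : Order.disp_t) T
    of Order.Lattice d T & monoid.Monoid T := {
  fleimp : T -> T -> T;
  flef : T;
  flemulC : commutative (@monoid.mul T);
  fle_residuation : forall x y z : T, (x * y <= z) = (y <= fleimp x z)
}.

#[short(type="fleType")]
HB.structure Definition FLe (d : Order.disp_t) :=
  { T of Lattice_isFLe d T & Order.Lattice d T & monoid.Monoid T }.

#[short(type="fleChainType")]
HB.structure Definition FLeChain (d : Order.disp_t) :=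
  { T of FLe d T & Order.Total d T }.

Local Notation "x ~> y" := (fleimp x y) (at level 55, right associativity).

Section Properties.
Context {d : Order.disp_t} (X : fleType d).
Implicit Types x : X.

Definition rescompl x : X := x ~> flef.

Definition fle_involutive : Prop := forall x, rescompl (rescompl x) = x.

Definition odd_involutive : Prop :=
  fle_involutive /\ rescompl 1 = 1.

Definition idempotent_elt x : Prop := x * x = x.

Definition idempotent_symmetric : Prop :=
  forall x, idempotent_elt x <-> idempotent_elt (rescompl x).

End Properties.

Definition dense_chain {d : Order.disp_t} (X : fleChainType d) : Prop :=
  (exists a b : X, a <> b) /\
  (forall a b : X, a < b -> exists c : X, a < c < b).

Definition fle_embedding {d d' : Order.disp_t} (X : fleType d) (Y : fleType d')
    (h : X -> Y) : Prop :=
  injective h /\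
  [/\ Order.meet_morphism h, Order.join_morphism h, monoid.monoid_morphism h,
      {morph h : x y / x ~> y} & h flef = flef].

(* Main.v *)
(* Let tau x = x -> x be the local unit of x, put down x = x . (tau x)' and
   up x = (down x')'. The elements with a given local unit u form a layer: a
   group, some of whose elements h may be doubled into down h < h.
   The dense extension is the lexicographic product X x Q with (x,s)' = (x',-s),
   into which X embeds as X x {0}. What has to be found is the product. For
   every local unit u and every rational a <> 0, adjoin a layer (u,a) with
   levels ordered lexicographically and u = (u,0): for a > 0, which is done
   only if u' is idempotent, it doubles the
   whole group of layer u, for a < 0 it doubles only those h with down h <> h.
   Its doubled elements are placed at (up x, a) and (down x, -a), respectively
   at (x, a) and (down x, -a); up to the choice of a preimage under "up", each
   (x,s) with s <> 0 occurs exactly once. To multiply, multiply the underlying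
   elements of X, and let the factor of the higher level decide the level and
   which of the two copies is taken (the lower copy wins a tie); this is
   associative because tau (x y) = max (tau x) (tau y). *)
Require Import Defs.
From HB Require Import structures.
From mathcomp Require Import all_boot all_order.
From mathcomp Require Import classical_sets cardinality.
From mathcomp Require Import all_algebra lra.

Set Implicit Arguments.
Unset Strict Implicit.
Unset Printing Implicit Defensive.

Import Order.TTheory.
Local Open Scope order_scope.
Local Open Scope group_scope.

Section OddInvolutiveChain.
Context {d : Order.disp_t} (X : fleChainType d).
Hypothesis oddX : odd_involutive X.
Implicit Types x y z u v w : X.

Local Notation cmp := (@rescompl _ X).

(** By [fleimpE] this is [x ~> x], the largest [y] with [x * y <= x]. *)
Definition local_unit x : X := cmp (x * cmp x).
Definition down x : X := x * (x * cmp x).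
Definition up x : X := cmp (down (cmp x)).

Local Notation tau := local_unit.

(** * Complement, residual and order *)

Lemma mulC x y : x * y = y * x. Proof. exact: flemulC. Qed.
Lemma mulA x y z : x * (y * z) = x * y * z. Proof. exact: monoid.mulgA. Qed.
Lemma mul1 x : 1 * x = x. Proof. exact: monoid.mul1g. Qed.
Lemma mulx1 x : x * 1 = x. Proof. exact: monoid.mulg1. Qed.
Lemma mulCA x y z : x * (y * z) = y * (x * z).
Proof. by rewrite mulA (mulC x) -mulA. Qed.
Lemma mulAC x y z : x * y * z = x * z * y.
Proof. by rewrite -mulA (mulC y) mulA. Qed.
Lemma mulACA x y z w : (x * y) * (z * w) = (x * z) * (y * w).
Proof. by rewrite -mulA (mulCA y) mulA. Qed.

Lemma cmpK x : cmp (cmp x) = x. Proof. by case: oddX => + _; apply. Qed.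
Lemma cmp1 : cmp 1 = 1. Proof. by case: oddX. Qed.
Lemma cmp_inj : injective cmp. Proof. exact: can_inj cmpK. Qed.

Lemma flef_one : flef = 1 :> X.
Proof.
rewrite -cmp1; apply: le_anti; rewrite /rescompl -!fle_residuation mul1 lexx /=.
by rewrite -[X in X <= _]mul1 fle_residuation.
Qed.

Lemma mul_le1 x y : (x * y <= 1) = (x <= cmp y).
Proof. by rewrite mulC fle_residuation -flef_one. Qed.
Lemma le_mul1 x y : (x <= y) = (x * cmp y <= 1).
Proof. by rewrite mul_le1 cmpK. Qed.
Lemma fleimpE x y : fleimp x y = cmp (x * cmp y).
Proof.
have H z : (z <= fleimp x y) = (z <= cmp (x * cmp y)).
  by rewrite -(fle_residuation x z y) -(mul_le1 z) (le_mul1 (x * z)) -mulA mulCA.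
by apply: le_anti; rewrite H lexx -H lexx.
Qed.

Lemma le_cmp x y : (cmp x <= cmp y) = (y <= x).
Proof. by rewrite -mul_le1 mulC mul_le1 cmpK. Qed.
Lemma lt_cmp x y : (cmp x < cmp y) = (y < x).
Proof. by rewrite !ltNge le_cmp. Qed.
Lemma cmp_le1 x : (cmp x <= 1) = (1 <= x).
Proof. by rewrite -{1}cmp1 le_cmp. Qed.
Lemma mul_cmp_le1 x : x * cmp x <= 1. Proof. by rewrite -le_mul1. Qed.

Lemma le_mulr z x y : x <= y -> x * z <= y * z.
Proof.
have H : y <= cmp (z * cmp (y * z)) by rewrite -mul_le1 mulA mul_cmp_le1.
by move=> xy; rewrite le_mul1 -mulA mul_le1 (le_trans xy H).
Qed.
Lemma le_mull z x y : x <= y -> z * x <= z * y.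
Proof. by rewrite !(mulC z); exact: le_mulr. Qed.
Lemma mul_ge1 x y : 1 <= y -> x <= x * y.
Proof. by move=> /(le_mull x); rewrite mulx1. Qed.
Lemma mul_le_id x y : y <= 1 -> x * y <= x.
Proof. by move=> /(le_mull x); rewrite mulx1. Qed.

(** * Local units *)

Lemma le_tau x y : (y <= tau x) = (x * y <= x).
Proof. by rewrite (le_mul1 (x * y)) /tau -mul_le1 -mulA mulCA. Qed.
Lemma tau_ge1 x : 1 <= tau x. Proof. by rewrite le_tau mulx1. Qed.
Lemma tau_cmp x : tau (cmp x) = tau x. Proof. by rewrite /tau cmpK mulC. Qed.
Lemma cmp_tau x : cmp (tau x) = x * cmp x. Proof. exact: cmpK. Qed.
Lemma cmp_tau_le1 x : cmp (tau x) <= 1. Proof. by rewrite cmp_le1 tau_ge1. Qed.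
Lemma mul_tau x : x * tau x = x.
Proof. by apply: le_anti; rewrite -le_tau lexx mul_ge1 // tau_ge1. Qed.
Lemma tau_idem x : tau x * tau x = tau x.
Proof.
apply: le_anti; rewrite le_tau mulA !mul_tau lexx /=.
by rewrite mul_ge1 // tau_ge1.
Qed.
Lemma tau_id u : 1 <= u -> u * u = u -> tau u = u.
Proof.
move=> u1 uu; apply: le_anti; rewrite le_tau uu lexx andbT.
by rewrite -[tau u]mul1 -[X in _ <= X](mul_tau u) le_mulr.
Qed.
Lemma tauK x : tau (tau x) = tau x.
Proof. by apply: tau_id; [exact: tau_ge1 | exact: tau_idem]. Qed.

(* If w, the unit of x y, exceeded both local units, then x w x' > 1 and
   y w y' > 1; but their product is x y x' y' <= 1. *)
Lemma tauM x y : tau (x * y) = Order.max (tau x) (tau y).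
Proof.
apply/eqP; rewrite eq_le ge_max !le_tau.
apply/andP; split; last first.
  by rewrite mulAC mul_tau lexx -mulA mul_tau lexx.
rewrite le_max; apply/negP => /negP; rewrite negb_or -!ltNge !ltNge !le_tau.
set w := tau _; rewrite (le_mul1 (x * w)) (le_mul1 (y * w)) -!ltNge => /andP[H1 H2].
have: 1 < (x * w * cmp x) * (y * w * cmp y).
  by apply: (lt_le_trans H1); apply: mul_ge1; exact: ltW.
rewrite mulACA (mulACA x) [w * w]tau_idem mul_tau -mulACA ltNge.
by rewrite (le_trans (mul_le_id _ _)) // mul_cmp_le1.
Qed.

Lemma tauM_eq x y : tau x = tau y -> tau (x * y) = tau x.
Proof. by move=> e; rewrite tauM e maxxx. Qed.
Lemma tauM_lt x y : tau x < tau y -> tau (x * y) = tau y.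
Proof. by move=> e; rewrite tauM (max_r (ltW e)). Qed.

Lemma ge_tau x : 1 <= x -> tau x <= x.
Proof. by move=> x1; rewrite -[X in _ <= X](mul_tau x) -{1}[tau x]mul1 le_mulr. Qed.
Lemma neq1 x : 1 < tau x -> x != 1.
Proof. by apply: contraTneq => ->; rewrite /tau mul1 cmpK ltxx. Qed.

(** * Doubled elements: [down] and [up] within and across layers *)

Lemma downE x : down x = x * cmp (tau x). Proof. by rewrite cmp_tau. Qed.
Lemma cmp_down x : cmp (down x) = up (cmp x). Proof. by rewrite /up cmpK. Qed.
Lemma cmp_up x : cmp (up x) = down (cmp x). Proof. exact: cmpK. Qed.
Lemma down_le x : down x <= x. Proof. by rewrite downE mul_le_id // cmp_tau_le1. Qed.
Lemma tau_down x : tau (down x) = tau x.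
Proof. by rewrite downE tauM_eq // tau_cmp tauK. Qed.
Lemma tau_up x : tau (up x) = tau x.
Proof. by rewrite /up tau_cmp tau_down tau_cmp. Qed.
Lemma down_fix_cmp x : (down (cmp x) == cmp x) = (up x == x).
Proof. by rewrite -(inj_eq cmp_inj) cmp_down cmpK. Qed.
Lemma up_fix_cmp x : (up (cmp x) == cmp x) = (down x == x).
Proof. by rewrite -down_fix_cmp cmpK. Qed.
Lemma tau_gt1 x : down x != x -> 1 < tau x.
Proof.
move=> h; rewrite lt_neqAle tau_ge1 andbT; apply: contraNneq h => e.
by rewrite downE -e cmp1 mulx1.
Qed.
(** The product [cmp (tau x) * tau y] has local unit [tau y]. It is at least 1, since otherwise
    [tau y <= tau x]; so [ge_tau] puts it above [tau y]. *)
Lemma cmp_tau_mul x y : tau x < tau y -> cmp (tau x) * y = y.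
Proof.
move=> xy; suff H : cmp (tau x) * tau y = tau y by rewrite -(mul_tau y) mulCA H.
have e : tau (cmp (tau x) * tau y) = tau y by rewrite tauM_lt ?tauK // tau_cmp !tauK.
apply: le_anti; rewrite {1}mulC mul_le_id ?cmp_tau_le1 //=.
rewrite -[X in X <= _]e ge_tau // leNgt; apply: contraTN xy => /ltW.
by rewrite mulC mul_le1 cmpK -leNgt.
Qed.

Lemma down_mul x y : tau y <= tau x -> down (x * y) = down x * y.
Proof. by move=> yx; rewrite !downE tauM (max_l yx) mulAC. Qed.
Lemma down_mul_lt x y : tau x < tau y -> down x * y = x * y.
Proof. by move=> xy; rewrite downE -mulA cmp_tau_mul. Qed.
Lemma mul_cmp_lt x y : tau x < tau y -> x * (cmp x * y) = y.
Proof. by move=> xy; rewrite mulA -cmp_tau cmp_tau_mul. Qed.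
(** Write [y] as [x * (cmp x * y)]. Replacing [cmp x] by [down (cmp x)], that is [cmp (up x)], does
    not change its product with [y], and this factor cancels [up x]. *)
Lemma up_mul_lt x y : tau x < tau y -> up x * y = x * y.
Proof.
move=> xy; rewrite -{1}(mul_cmp_lt xy) mulCA -(@down_mul_lt (cmp x)) ?tau_cmp //.
by rewrite -cmp_up mul_cmp_lt // tau_up.
Qed.

(** A doubled upper element is thus invertible in its layer. The product exceeds 1 because
    [down x < x], so it is above its local unit. *)
Lemma mul_cmp_down x : down x != x -> x * cmp (down x) = tau x.
Proof.
move=> h; have h1 := tau_gt1 h; apply: le_anti; apply/andP; split.
  rewrite (le_mul1 _ (tau x)) -mulA (mulC (cmp _)) mulA -downE; exact: mul_cmp_le1.
have e : tau (x * cmp (down x)) = tau x by rewrite tauM_eq // tau_cmp tau_down.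
rewrite -[X in X <= _]e ge_tau // ltW // ltNge -le_mul1 -ltNge.
by rewrite lt_neqAle h down_le.
Qed.

Lemma up_down x : down x != x -> up (down x) = x.
Proof.
move=> h; rewrite /up -[RHS]cmpK; congr cmp.
rewrite downE tau_cmp tau_down cmp_tau mulCA (mulC _ (cmp x)) mulCA mul_cmp_down //.
by rewrite -(tau_cmp x) mul_tau.
Qed.
Lemma down_up x : up x != x -> down (up x) = x.
Proof.
rewrite -down_fix_cmp => /up_down; rewrite -[up x]cmpK cmp_up => e.
by rewrite -[LHS]cmpK cmp_down cmpK e cmpK.
Qed.

(* When [(tau x)'] is idempotent, [down] and [up] are idempotent on the layer
   of [x]; otherwise the layer is a discrete group in which they are the
   predecessor and the successor. *)
Definition idem_layer x := cmp (tau x) * cmp (tau x) == cmp (tau x).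

Lemma idem_layer_tau x y : tau x = tau y -> idem_layer x = idem_layer y.
Proof. by rewrite /idem_layer => ->. Qed.
Lemma idem_layer_cmp x : idem_layer (cmp x) = idem_layer x.
Proof. exact/idem_layer_tau/tau_cmp. Qed.
Lemma idem_layer_down x : down x = x -> idem_layer x.
Proof.
by move=> h; apply/eqP; rewrite {1}cmp_tau mulAC -downE h cmp_tau.
Qed.
Lemma idem_layer_up x : up x = x -> idem_layer x.
Proof. by move=> /eqP; rewrite -down_fix_cmp -idem_layer_cmp => /eqP /idem_layer_down. Qed.

Lemma down_down x : idem_layer x -> down (down x) = down x.
Proof. by move=> idx; rewrite [LHS]downE tau_down downE -mulA (eqP idx). Qed.
Lemma up_up x : idem_layer x -> up (up x) = up x.
Proof.
by rewrite -idem_layer_cmp => /down_down e; apply: cmp_inj; rewrite !cmp_up e.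
Qed.
Lemma down_up_idem x : idem_layer x -> down (up x) = down x.
Proof.
move=> idx; have [->//|h] := eqVneq (up x) x.
by rewrite -[in RHS](down_up h) down_down ?(idem_layer_tau (tau_up x)).
Qed.
Lemma up_down_idem x : idem_layer x -> up (down x) = up x.
Proof.
rewrite -idem_layer_cmp => /down_up_idem e; apply: cmp_inj.
by rewrite !cmp_up cmp_down e.
Qed.
Lemma down_up_mul x y : idem_layer (x * y) -> down (up x * y) = down (x * y).
Proof.
have [yx|xy] := leP (tau y) (tau x); last by rewrite up_mul_lt.
move=> idxy; rewrite down_mul ?tau_up // down_mul // down_up_idem //.
by rewrite -(idem_layer_tau (_ : tau (x * y) = tau x)) // tauM (max_l yx).
Qed.
Lemma up_up_mul x y : idem_layer (x * y) -> up (up x * y) = up (x * y).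
Proof.
move=> idxy; rewrite -up_down_idem ?down_up_mul ?up_down_idem //.
by rewrite (idem_layer_tau (_ : _ = tau (x * y))) // !tauM tau_up.
Qed.

(** A factor fixed by [down] sees the other factor [z] only through [down z], and [up y] and [y]
    have the same [down]. *)
Lemma mul_up_down x y : down x = x -> tau x = tau y -> x * up y = x * y.
Proof.
move=> dx xy; have idy : idem_layer y by rewrite -(idem_layer_tau xy) idem_layer_down.
have e z : tau z = tau x -> x * z = x * down z.
  by move=> h; rewrite downE h mulCA -downE dx mulC.
by rewrite e ?tau_up // down_up_idem // -e.
Qed.

Lemma up_le1 x : 1 < tau x -> (up x <= 1) = (x < cmp (tau x)).
Proof.
move=> x1; rewrite ltNge -{3}[x]cmpK -mul_le1 mulC -(tau_cmp x) -downE -cmp_up.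
by rewrite (cmp_le1 (up x)) -ltNge lt_neqAle neq1 ?tau_up.
Qed.

(** If [down y < x], then [x * cmp (down y)] exceeds 1, hence is above the local unit; multiplying
    by [y], the inverse of [cmp (down y)], gives [y <= x]. *)
Lemma lt_down x y : tau x = tau y -> down y != y -> (x < y) = (x <= down y).
Proof.
move=> xy h; apply/idP/idP => [xly|]; last first.
  by move/le_lt_trans; apply; rewrite lt_neqAle h down_le.
rewrite leNgt; apply: contraTN xly; rewrite -leNgt ltNge le_mul1 -ltNge => /ltW /ge_tau.
rewrite tauM_eq ?tau_cmp ?tau_down // => /(le_mulr y).
by rewrite -mulA (mulC (cmp _) y) mul_cmp_down // xy mulC mul_tau -xy mul_tau.
Qed.

Lemma up_mul_gt x y : tau x < tau y -> up (x * y) = x * up y.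
Proof.
have le1 z t : tau z < tau t -> z * up t <= up (z * t).
  move=> zt; rewrite le_mul1 cmp_up downE mulACA tau_cmp (tauM_lt zt).
  apply: le_trans (mul_cmp_le1 (up t)); rewrite cmp_up downE tau_cmp [leRHS]mulCA.
  by apply: le_mulr; rewrite -mul_le1 mulAC mul_cmp_le1.
move=> xy; apply: le_anti; rewrite le1 // andbT.
(* For the converse, apply [le1] to [cmp x] and [x * y], then multiply by [x]. *)
have xxy : tau x < tau (up (x * y)) by rewrite tau_up tauM_lt.
rewrite -(mul_cmp_lt xxy); apply: le_mull; apply: le_trans (le1 _ _ _) _.
  by rewrite tau_cmp tauM_lt.
by rewrite mulCA mul_cmp_lt.
Qed.

(** The product of [x * y] and [cmp x * cmp y] is [cmp (tau x)], by idempotency. Multiplying it by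
    [cmp (x * y)] yields either side, depending on the grouping. *)
Lemma down_cmp_mul x y : idem_layer x -> tau x = tau y ->
  down (cmp (x * y)) = down (cmp x * cmp y).
Proof.
move=> idx xy; have e : x * y * (cmp x * cmp y) = cmp (tau x).
  by rewrite mulACA -!cmp_tau -xy (eqP idx).
rewrite !downE !tauM_eq ?tau_cmp ?tauM_eq // -{1}e mulA (mulC _ (x * y)).
by rewrite -cmp_tau tauM_eq // mulC.
Qed.

Lemma up_mul_le1 x y : 1 < tau x -> tau x = tau y -> up x = x ->
  (up (x * y) <= 1) = (x < cmp y).
Proof.
move=> x1 xy ux; have idx := idem_layer_up ux.
have dx : down (cmp x) = cmp x by apply/eqP; rewrite down_fix_cmp ux.
rewrite up_le1 tauM_eq // !ltNge le_mul1 mulC -(tauM_eq xy) -(tau_cmp (x * y)) -downE.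
by rewrite down_cmp_mul // down_mul ?tau_cmp ?xy // dx mulC mul_le1 cmpK.
Qed.


(** * Encoding of the lexicographic product by layered elements *)

Local Notation mirror := (X *l rat).
Local Notation key := (X *l (rat *l bool)).
Implicit Types (p q : mirror) (t : X * key).

(* [p] is the lower one of the two copies of a doubled element. *)
Definition lower p : bool :=
  (0 < p.2)%R && (up p.1 != p.1) || (p.2 < 0)%R && (down p.1 == p.1).

(* A pair [(z, (w, (a, f)))] stands for the element [z] of layer [(w, a)], in
   its lower copy if [f]. Since [false < true], the maximum of two keys
   implements the rule that the lower copy wins a tie. *)
Definition enc p : X * key :=
  if lower p then (up p.1, (tau p.1, ((- p.2)%R, true))) else (p.1, (tau p.1, (p.2, false))).

Definition dec t : mirror :=
  let: (z, (_, (a, f))) := t in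
  if f then (down z, (- a)%R) else ((if (0 < a)%R then up z else z), a).

(** This is weaker than lying in the range of [enc], where [up z = z] holds at levels [a > 0]:
    [mulT] need not preserve that equation. *)
Definition valid t : Prop :=
  let: (z, (w, (a, f))) := t in
  [/\ tau z = w, (a < 0)%R -> down z != z, (0 < a)%R -> idem_layer z & a = 0%R -> f = false].

Definition mulT t t' : X * key := (t.1 * t'.1, Order.max t.2 t'.2).

Lemma enc_valid p : valid (enc p).
Proof.
case: p => x s; rewrite /enc /lower /=.
case: (ltgtP s 0%R) => [s0|s0|->] /=; last by split=> //; rewrite ltxx.
- case: eqVneq => dx /=; split; rewrite ?tau_up //; try by move=> h; exfalso; lra.
  by rewrite (idem_layer_tau (tau_up x)) => _; exact: idem_layer_down.
- rewrite orbF; case: eqVneq => ux /=; split; rewrite ?tau_up //; try by move=> h; exfalso; lra.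
  + by move=> _; exact: idem_layer_up.
  + by rewrite down_up // eq_sym.
Qed.

Lemma encK p : dec (enc p) = p.
Proof.
case: p => x s; rewrite /enc /lower /=.
case: (ltgtP s 0%R) => [s0|s0|->] /=; last by [].
- case: eqVneq => dx /=; last by rewrite (lt_gtF s0).
  by rewrite GRing.opprK down_up_idem ?dx //; exact: idem_layer_down.
- rewrite orbF; case: eqVneq => ux /=; first by rewrite s0 ux.
  by rewrite GRing.opprK down_up.
Qed.

Lemma decK t : valid t -> enc (dec t) = ((if (0 < t.2.2.1)%R then up t.1 else t.1), t.2).
Proof.
case: t => z [w [a f]] [/= <- d0 i0 f0].
rewrite /enc /lower; case: f f0 => f0 /=.
  case: (ltgtP a 0%R) => a0; last by have := f0 a0.
    rewrite Num.Theory.oppr_gt0 a0 /= up_down ?d0 // eq_sym d0 //=.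
    by rewrite tau_down GRing.opprK.
  rewrite Num.Theory.oppr_gt0 (lt_gtF a0) Num.Theory.oppr_lt0 a0 /=.
  by rewrite down_down ?i0 // eqxx up_down_idem ?i0 // tau_down GRing.opprK.
case: (ltgtP a 0%R) => [a0|a0|//] /=; first by rewrite (negPf (d0 a0)).
by rewrite up_up ?eqxx ?tau_up ?i0.
Qed.

Lemma le_key w w' a a' (f f' : bool) :
  ((w, (a, f)) <= (w', (a', f')) :> key) =
  (w < w') || (w == w') && ((a < a')%R || (a == a') && (f ==> f')).
Proof. by rewrite !leEprodlexi /=; do 2!case: ltgtP => //= _; case: f f' => [] []. Qed.

Lemma le_mirror x y (s r : rat) :
  ((x, s) <= (y, r) :> mirror) = (x < y) || (x == y) && (s <= r)%R.
Proof. by rewrite leEprodlexi /=; case: ltgtP. Qed.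

Lemma mulTC t t' : mulT t t' = mulT t' t.
Proof. by rewrite /mulT mulC maxC. Qed.
Lemma mulTA t1 t2 t3 : mulT t1 (mulT t2 t3) = mulT (mulT t1 t2) t3.
Proof. by rewrite /mulT /= mulA maxA. Qed.

Lemma down_mul_neq x y : down y != y -> (tau x < tau y) || (tau x == tau y) && (down x != x) ->
  down (x * y) != x * y.
Proof.
move=> dy H; apply: contra dy => /eqP e.
have yx : tau x <= tau y by case/orP: H => [/ltW//|/andP[/eqP->]].
(* Multiplication by [x] is injective on the layer of [y]: it is undone by [cmp x] if [x] lies in a
   lower layer, by [cmp (down x)] if in the same one. *)
have [i iK] : exists i, forall z, tau z = tau y -> i * (x * z) = z.
  case/orP: H => [xy|/andP[/eqP xy dx]]; [exists (cmp x)|exists (cmp (down x))] => z zy.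
    by rewrite mulCA mul_cmp_lt // zy.
  by rewrite mulA (mulC _ x) mul_cmp_down // xy -zy mulC mul_tau.
move: e; rewrite mulC down_mul // mulC (mulC y) => /(congr1 (fun z => i * z)).
by rewrite !iK ?tau_down // => ->.
Qed.

Lemma valid_mul t t' : valid t -> valid t' -> valid (mulT t t').
Proof.
wlog : t t' / t.2 <= t'.2.
  by move=> W vt vt'; case/orP: (le_total t.2 t'.2) => h; [|rewrite mulTC]; apply: W.
case: t t' => z [w [a f]] [z' [w' [a' f']]]; rewrite /mulT => /= le_k.
rewrite max_r //; move: le_k; rewrite le_key => le_k [e d0 i0 f0] [e' d0' i0' f0'].
have ew : tau (z * z') = w'.
  by rewrite tauM e e' max_r //; case/orP: le_k => [/ltW//|/andP[/eqP->]].
split=> // [a'0|a'0]; last first.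
  by rewrite (idem_layer_tau (_ : _ = tau z')) ?e' ?i0'.
apply: down_mul_neq; rewrite ?d0' // e e'; case/orP: le_k => [->//|/andP[-> aa']].
rewrite d0 ?orbT //; case/orP: aa' => [h|/andP[/eqP-> //]]; exact: lt_trans a'0.
Qed.

(** Key to associativity: re-encoding changes [z] at most to [up z]. This is invisible if the other
    factor lies in a higher layer; otherwise the product has positive level, where [dec] ignores the
    choice. *)
Lemma dec_mulT_decl t t' : valid t -> valid t' ->
  dec (mulT (enc (dec t)) t') = dec (mulT t t').
Proof.
move=> vt vt'; rewrite decK //; case: ifP => [a0|_]; last by case: t {vt}.
case: t t' a0 vt vt' => z [w [a f]] [z' [w' [a' f']]] /= a0 [e d0 i0 f0] [e' d0' i0' f0'].
rewrite /mulT /=; have [zz'|z'z] := ltP (tau z) (tau z'); first by rewrite up_mul_lt.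
have idz : idem_layer (z * z').
  by rewrite (idem_layer_tau (_ : _ = tau z)) ?i0 // tauM (max_l z'z).
suff: (0 < (Order.max ((w, (a, f)) : key) (w', (a', f'))).2.1)%R.
  case: Order.max => _ [b []] /= b0; first by rewrite down_up_mul.
  by rewrite b0 up_up_mul.
case: (leP ((w, (a, f)) : key) (w', (a', f'))) => //; rewrite le_key -e -e' (le_gtF z'z) /=.
by case/andP=> _ /orP[/(lt_trans a0)//|/andP[/eqP<-]].
Qed.

(** * The commutative monoid on pairs *)

Definition mulm p q := dec (mulT (enc p) (enc q)).
Definition onem : mirror := (1, 0%R).
Definition cmpm p : mirror := (cmp p.1, (- p.2)%R).

Lemma mulmC : commutative mulm.
Proof. by move=> p q; rewrite /mulm mulTC. Qed.

Lemma mulmA : associative mulm.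
Proof.
have H p q r : mulm (mulm p q) r = dec (mulT (mulT (enc p) (enc q)) (enc r)).
  by rewrite /mulm dec_mulT_decl //; [apply: valid_mul|]; exact: enc_valid.
by move=> p q r; rewrite mulmC !H mulTC mulTA.
Qed.

Lemma enc1 : enc onem = (1, (1, (0%R, false))).
Proof. by rewrite /enc /lower /onem /= /tau mul1 !cmp1. Qed.

Lemma mul1m : left_id onem mulm.
Proof.
move=> p; rewrite -[RHS]encK /mulm /mulT enc1.
case: (enc p) (enc_valid p) => z [w [a f]] /= [<- d0 i0 f0]; rewrite mul1.
(* The key of the unit is the least valid one: layer 1 has no negative level, since [down] fixes all
   its elements. *)
rewrite max_r // le_key; have := tau_ge1 z; rewrite le_eqVlt => /orP[/eqP e|->//].
rewrite -e eqxx ltxx /=; case: (ltgtP 0%R a) => // a0.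
by have := tau_gt1 (d0 a0); rewrite -e ltxx.
Qed.

Lemma cmpmK : involutive cmpm.
Proof. by case=> x s; rewrite /cmpm /= cmpK GRing.opprK. Qed.

(** * Residuation for the product on pairs *)

Lemma tau_dec t : tau (dec t).1 = tau t.1.
Proof.
by case: t => z [w [a []]] /=; rewrite ?tau_down //; case: ifP => // _; rewrite tau_up.
Qed.

Lemma tau_enc p : tau (enc p).1 = tau p.1.
Proof. by rewrite -tau_dec encK. Qed.

Lemma mul_enc x p : tau p.1 < tau x -> x * (enc p).1 = x * p.1.
Proof.
by rewrite /enc; case: ifP => //= _ px; rewrite mulC up_mul_lt // mulC.
Qed.

Lemma dec_mul z x k : tau x < tau z -> (dec (z * x, k)).1 = (dec (z, k)).1 * x.
Proof.
case: k => w [a []] xz /=; first by rewrite down_mul // ltW.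
by case: ifP => // _; rewrite mulC up_mul_gt // mulC.
Qed.

Lemma le_one p : 1 < tau p.1 -> (p <= onem) = (p.1 <= 1).
Proof.
by case: p => x s /neq1 x1; rewrite le_mirror (negPf x1) orbF le_eqVlt (negPf x1).
Qed.

Lemma le_cmpm p q : (p <= cmpm q) = (q <= cmpm p).
Proof.
case: p q => x s [y r]; rewrite !le_mirror -(lt_cmp _ x) cmpK -(inj_eq cmp_inj x) cmpK.
by rewrite (eq_sym y); congr (_ || _ && _) => /=; apply/idP/idP => h; lra.
Qed.

(** The key of [p] prevails and the first component is [p.1 * q.1]. The rationals do not matter, as
    [p.1] and [cmp q.1] lie in different layers. *)
Lemma mulm_le1_lt p q : tau q.1 < tau p.1 -> (mulm p q <= onem) = (p <= cmpm q).
Proof.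
move=> qp; have p1 : 1 < tau p.1 := le_lt_trans (tau_ge1 _) qp.
have ek : Order.max (enc p).2 (enc q).2 = (enc p).2.
  by rewrite max_l // /enc; do 2!case: ifP => _; rewrite le_key qp.
have e : (mulm p q).1 = p.1 * q.1.
  rewrite /mulm /mulT ek dec_mul ?tau_enc // -surjective_pairing encK mul_enc //.
rewrite le_one e; last by rewrite tauM lt_max p1.
rewrite mul_le1 le_eqVlt; case: p q qp {p1 ek e} => x s [y r] /= yx.
rewrite le_mirror; case: eqVneq => [e|_] /=; last by rewrite orbF.
by move: yx; rewrite e tau_cmp ltxx.
Qed.

Lemma enc_tau1 x s : tau x = 1 -> enc (x, s) = (x, (1, (`|s|%R, (s < 0)%R))).
Proof.
move=> x1; have dx y : tau y = 1 -> down y = y by move=> e; rewrite downE e cmp1 mulx1.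
have ux : up x = x by rewrite /up dx ?cmpK // tau_cmp.
rewrite /enc /lower /= dx // ux eqxx andbT andbF /= x1.
by case: ltP => s0; rewrite ?(Num.Theory.ltr0_norm s0) ?(Num.Theory.ger0_norm s0).
Qed.

Lemma dec_tau1 x k : tau x = 1 -> dec (x, k) = (x, if k.2.2 then (- k.2.1)%R else k.2.1).
Proof.
move=> x1; have dx y : tau y = 1 -> down y = y by move=> e; rewrite downE e cmp1 mulx1.
have ux : up x = x by rewrite /up dx ?cmpK // tau_cmp.
by case: k => w [a []] /=; rewrite ?dx // ux if_same.
Qed.

(** On layer 1 the product is componentwise, with the Sugihara product on the rationals: the larger
    absolute value wins, and the negative one on ties. *)
Lemma mulm_le1_tau1 x y s r : tau x = 1 -> tau y = 1 ->
  (enc (y, r)).2 <= (enc (x, s)).2 ->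
  (mulm (x, s) (y, r) <= onem) = (((x, s) : mirror) <= cmpm (y, r)).
Proof.
move=> x1 y1; rewrite /mulm /mulT !enc_tau1 // => le_k.
rewrite max_l // dec_tau1 /=; last by rewrite tauM x1 y1 maxxx.
move: le_k; rewrite le_key ltxx eqxx /= => le_k.
have -> : ((x * y, if (s < 0)%R then (- `|s|)%R else `|s|%R) : mirror) = (x * y, s).
  by case: ltP => s0; rewrite ?(Num.Theory.ltr0_norm s0) ?(Num.Theory.ger0_norm s0) ?GRing.opprK.
have E : (x * y == 1) = (x == cmp y).
  have yy1 : y * cmp y = 1 by rewrite -cmp_tau y1 cmp1.
  by apply/eqP/eqP => [e|->]; [rewrite -[x]mulx1 -yy1 mulA e mul1 | rewrite mulC].
rewrite !le_mirror E lt_neqAle E mul_le1 -lt_neqAle /=; congr (_ || _ && _).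
move: le_k; case: (ltP s 0%R) => s0; case: (ltP r 0%R) => r0;
  rewrite ?(Num.Theory.ltr0_norm s0) ?(Num.Theory.ger0_norm s0)
    ?(Num.Theory.ltr0_norm r0) ?(Num.Theory.ger0_norm r0) ?andbT ?andbF ?orbF => h;
  apply/idP/idP => h'; lra.
Qed.

Lemma enc_lower x s : lower (x, s) -> enc (x, s) = (up x, (tau x, ((- s)%R, true))).
Proof. by rewrite /enc => ->. Qed.
Lemma enc_upper x s : ~~ lower (x, s) -> enc (x, s) = (x, (tau x, (s, false))).
Proof. by rewrite /enc => /negPf->. Qed.

(* p and q lie in the same layer, above the group of units, and p determines
   the level of the product. *)
Lemma mulm_le1_eq x y s r : 1 < tau x -> tau x = tau y ->
  (enc (y, r)).2 <= (enc (x, s)).2 ->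
  (mulm (x, s) (y, r) <= onem) = (((x, s) : mirror) <= cmpm (y, r)).
Proof.
move=> x1 xy le_k; rewrite le_one; last by rewrite tau_dec /= tauM_eq !tau_enc.
rewrite /mulm /mulT max_l // le_mirror /=; move: le_k.
have idx_mul : idem_layer x -> forall z, tau z = tau x -> idem_layer (x * z).
  by move=> idx z zx; rewrite (idem_layer_tau (_ : _ = tau x)) // tauM_eq.
(* The target is [x <= cmp y] if [s <= - r] and [x < cmp y] otherwise; the two agree when
   [x != cmp y]. *)
have leE : (s <= - r)%R -> (x * y <= 1) = (x < cmp y) || (x == cmp y) && (s <= - r)%R.
  by move=> ->; rewrite andbT orbC -le_eqVlt mul_le1.
have ltE : (- r < s)%R -> (x < cmp y) = (x < cmp y) || (x == cmp y) && (s <= - r)%R.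
  by move=> h; rewrite [X in _ && X]leNgt h andbF orbF.
have neqE : x != cmp y -> (x < cmp y) || (x == cmp y) && (s <= - r)%R = (x < cmp y).
  by move=> /negPf ->; rewrite orbF.
have up_lt : up y != y -> (x * up y <= 1) = (x < cmp y).
  by move=> uy; rewrite mul_le1 cmp_up lt_down ?tau_cmp // down_fix_cmp.
have down_up_le z : down x = x -> tau z = tau x -> down (up x * z) = x * z.
  move=> dx zx; rewrite down_up_mul ?down_mul ?dx ?zx //.
  by apply: idx_mul => //; exact: idem_layer_down.
have neq_up : down x = x -> up y != y -> x != cmp y.
  by move=> dx; apply: contraNneq => e; rewrite -down_fix_cmp -e dx.
have neq_down : up x = x -> down y != y -> x != cmp y.
  by move=> ux; apply: contraNneq => e; rewrite -up_fix_cmp -e ux.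
have [ly|uy] := boolP (lower (y, r)); have [lx|ux] := boolP (lower (x, s));
  rewrite ?(enc_lower ly) ?(enc_upper uy) ?(enc_lower lx) ?(enc_upper ux) /=;
  rewrite le_key xy ltxx eqxx /= => le_k.
(* Both are lower copies; the order of the keys excludes [r < 0 < s]. *)
- case/orP: lx => /andP[/= s0 hx]; case/orP: ly => /andP[/= r0 hy];
  try by exfalso; clear -le_k s0 r0; lra.
  + by rewrite down_mul ?tau_up ?xy // down_up // up_lt //; apply: ltE; clear -le_k s0; lra.
  + rewrite down_up_le ?tau_up ?(eqP hx) // mul_up_down ?(eqP hx) // neqE ?neq_up ?(eqP hx) //.
    by rewrite mul_le1 le_eqVlt (negPf (neq_up _ _)) ?(eqP hx).
  + rewrite down_up_le ?tau_up ?(eqP hx) // mul_up_down ?(eqP hx) //.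
    by apply: leE; clear -s0 r0; lra.
- case: ltP => s0.
    have hx : up x = x by move: ux; rewrite /lower /= s0 negb_or /= => /andP[/negPn/eqP].
    rewrite mulC up_up_mul; last by rewrite mulC idx_mul //; exact: idem_layer_up.
    by rewrite mulC up_mul_le1 //; apply: ltE; clear -le_k s0; lra.
  case/orP: ly => /andP[/= r0 hy]; last by exfalso; clear -le_k s0 r0; lra.
  by rewrite up_lt //; apply: ltE; clear -le_k s0 r0; lra.
- case/orP: lx => /andP[/= s0 hx].
    by rewrite down_mul ?tau_up ?xy // down_up //; apply: leE; clear -le_k s0; lra.
  by rewrite down_up_le ?(eqP hx) //; apply: leE; clear -le_k s0; lra.
- case: ltP => s0; last by apply: leE; clear -le_k s0; lra.
  have hx : up x = x by move: ux; rewrite /lower /= s0 negb_or /= => /andP[/negPn/eqP].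
  rewrite up_mul_le1 //; case: (ltP r 0%R) => r0; last by apply: ltE; clear -s0 r0; lra.
  have hy : down y != y by move: uy; rewrite /lower /= r0 negb_or => /andP[_].
  by rewrite neqE ?neq_down.
Qed.

(** With associativity, this yields residuation. Both sides are symmetric in [p] and [q], so the
    factor with the larger key may come first. *)
Lemma mulm_le1 p q : (mulm p q <= onem) = (p <= cmpm q).
Proof.
wlog le_k : p q / (enc q).2 <= (enc p).2.
  move=> W; case/orP: (le_total (enc q).2 (enc p).2) => h; first exact: W.
  by rewrite mulmC le_cmpm; exact: W.
case: (ltgtP (tau q.1) (tau p.1)) => [qp|pq|e]; first exact: mulm_le1_lt.
  by rewrite mulmC le_cmpm; exact: mulm_le1_lt.
case: p q le_k e => x s [y r] /= le_k e; have := tau_ge1 x; rewrite le_eqVlt => /orP[/eqP x1|x1].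
  by apply: mulm_le1_tau1; rewrite ?e.
exact: mulm_le1_eq.
Qed.

(** * Embedding, idempotents and density *)

Definition embed x : mirror := (x, 0%R).

Lemma enc_embed x : enc (embed x) = (x, (tau x, (0%R, false))).
Proof. by []. Qed.

Lemma mul_embed x y : mulm (embed x) (embed y) = embed (x * y).
Proof. by rewrite /mulm /mulT !enc_embed /= /Order.max; case: ifP. Qed.

Lemma cmpm_embed x : cmpm (embed x) = embed (cmp x).
Proof. by rewrite /cmpm GRing.oppr0. Qed.

Lemma mulm_residuation p q r : (mulm p q <= r) = (q <= cmpm (mulm p (cmpm r))).
Proof. by rewrite -{1}[r]cmpmK -!mulm_le1 (mulmC p q) mulmA. Qed.

(** The pair and its complement are the two copies of a doubled element. At positive level both
    equations reduce to [x * x = x]; at negative level [x] is invertible in its layer, and both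
    amount to [x = tau x]. *)
Lemma idempotent_cmpm_neg p : (p.2 < 0)%R ->
  mulm p p = p <-> mulm (cmpm p) (cmpm p) = cmpm p.
Proof.
case: p => x s /= s0; have ns0 : (0 < - s)%R by rewrite Num.Theory.oppr_gt0.
rewrite /mulm /mulT !maxxx /cmpm /=; have [dx|dx] := eqVneq (down x) x.
  have lx : lower (x, s) by rewrite /lower /= s0 dx eqxx orbT.
  have ucx : ~~ lower (cmp x, (- s)%R).
    by rewrite /lower /= ns0 up_fix_cmp dx eqxx (lt_gtF ns0).
  have idx := idem_layer_down dx.
  rewrite (enc_lower lx) (enc_upper ucx) /= ns0 GRing.opprK.
  have -> : down (up x * up x) = x * x.
    rewrite down_up_mul; last by rewrite (idem_layer_tau (_ : _ = tau x)) // tauM_eq ?tau_up.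
    by rewrite down_mul ?tau_up // dx mul_up_down.
  have -> : up (cmp x * cmp x) = cmp (x * x).
    apply: cmp_inj; rewrite cmp_up down_cmp_mul ?idem_layer_cmp //.
    by rewrite !cmpK down_mul // dx.
  by split=> [[->]|[/cmp_inj ->]].
have ux : ~~ lower (x, s) by rewrite /lower /= (lt_gtF s0) (negPf dx) andbF.
have lcx : lower (cmp x, (- s)%R) by rewrite /lower /= ns0 up_fix_cmp dx.
rewrite (enc_upper ux) (enc_lower lcx) /= (lt_gtF s0) GRing.opprK.
have ucx : up (cmp x) != cmp x by rewrite up_fix_cmp.
rewrite down_mul // down_up // -cmp_down.
have xi := mul_cmp_down dx; split=> [[xx]|[yi]].
  have e : x = tau x by rewrite -xi -{2}xx -mulA xi mul_tau.
  have -> : cmp (down x) = tau x.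
    by rewrite -[LHS]mul_tau tau_cmp tau_down -[in LHS]e mulC xi.
  by rewrite -(tau_cmp x) mul_tau.
have i_le : cmp (down x) <= tau x by rewrite -(tau_cmp x) le_tau yi.
have yx : cmp x * x = cmp x by rewrite -[X in X * x]yi -mulA (mulC _ x) xi -(tau_cmp x) mul_tau.
have -> : x = tau x; last by rewrite tau_idem.
apply: le_anti; rewrite -{1}(tau_cmp x) le_tau yx lexx /=.
by rewrite -[X in X <= _]xi -[X in _ <= X]mul_tau le_mull.
Qed.

Lemma idempotent_cmpm p : idempotent_symmetric X ->
  mulm p p = p <-> mulm (cmpm p) (cmpm p) = cmpm p.
Proof.
move=> symX; case: (ltgtP p.2 0%R) => p0; first exact: idempotent_cmpm_neg.
  rewrite -[X in mulm X X = X <-> _]cmpmK; apply: iff_sym.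
  by apply: idempotent_cmpm_neg; rewrite Num.Theory.oppr_lt0.
have -> : cmpm p = embed (cmp p.1) by rewrite /cmpm p0 GRing.oppr0.
have -> : p = embed p.1 by case: p p0 => x s /= ->.
rewrite !mul_embed; have := symX p.1; rewrite /idempotent_elt => -[h h'].
by split=> -[xx]; [rewrite h|rewrite h'].
Qed.

Lemma dense_mirror p q : p < q -> exists r, p < r < q.
Proof.
case: p q => x s [y r].
have ltE z w (a b : rat) : ((z, a) < (w, b) :> mirror) = (z < w) || (z == w) && (a < b)%R.
  by rewrite lt_leAnge !le_mirror; case: ltgtP => //= _; rewrite -lt_leAnge.
rewrite ltE => /orP[xy|/andP[/eqP <- sr]].
  exists (x, s + 1)%R; rewrite !ltE xy eqxx ltxx /= andbT; lra.
by exists (x, (s + r) / 2)%R; rewrite !ltE eqxx ltxx /=; apply/andP; split; lra.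
Qed.

End OddInvolutiveChain.

(** * The dense chain and its properties *)

Section Densification.
Context {d : Order.disp_t} (X : fleChainType d).
Implicit Type oddX : odd_involutive X.

(** The proof [oddX] indexes the type so that instances whose laws rest on it can be declared. *)
Definition densification oddX : Type := X *l rat.

HB.instance Definition _ oddX := Order.Total.copy (densification oddX) (X *l rat).

HB.instance Definition _ oddX := monoid.isMonoid.Build (densification oddX)
  (mulmA oddX) (mul1m oddX) (fun p => etrans (mulmC p _) (mul1m oddX p)).

HB.instance Definition _ oddX := Lattice_isFLe.Build _ (densification oddX) (onem X) (@mulmC _ X)
  (mulm_residuation oddX).

Context (oddX : odd_involutive X).
Local Notation Y := (densification oddX).

Lemma rescompl_mirror (p : Y) : rescompl p = cmpm p.
Proof.
change (cmpm (mulm p (cmpm (onem X))) = cmpm p).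
have -> : cmpm (onem X) = onem X by rewrite /cmpm cmp1 // GRing.oppr0.
by rewrite mulmC mul1m.
Qed.

Lemma odd_densification : odd_involutive Y.
Proof.
split; first by move=> p; rewrite !rescompl_mirror; exact: cmpmK.
by rewrite rescompl_mirror; congr pair; exact: cmp1.
Qed.

Lemma dense_densification : dense_chain Y.
Proof.
split; last exact: dense_mirror.
by exists (1, 0%R), (1, 1%R).
Qed.

Lemma countable_densification : countable [set: X] -> countable [set: Y].
Proof.
by move=> cX; rewrite -setXTT; apply: countableX => //; exact: countableP.
Qed.

Lemma idempotent_symmetric_densification :
  idempotent_symmetric X -> idempotent_symmetric Y.
Proof.
by move=> symX p; rewrite rescompl_mirror; exact: idempotent_cmpm.
Qed.

Lemma embed_densification : @fle_embedding _ _ X Y (@embed _ X).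
Proof.
have le_embed x y : ((embed x : Y) <= embed y) = (x <= y).
  by rewrite [LHS]le_mirror lexx andbT orbC -le_eqVlt.
split; first by move=> x y [].
split.
- by move=> x y; rewrite !meetEtotal /Order.min !lt_leAnge !le_embed; case: ifP.
- by move=> x y; rewrite !joinEtotal /Order.max !lt_leAnge !le_embed; case: ifP.
- by split=> // x y; rewrite -mul_embed.
- move=> x y; rewrite (fleimpE oddX) -cmpm_embed -mul_embed -cmpm_embed.
  by rewrite (fleimpE odd_densification) !rescompl_mirror.
- by rewrite (flef_one oddX).
Qed.
End Densification.

Local Open Scope classical_set_scope.

Theorem corollary4p5 :
  (forall (d : Order.disp_t) (X : fleChainType d),
     countable [set: X] -> odd_involutive X ->
     exists (d' : Order.disp_t) (Y : fleChainType d') (h : X -> Y),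
       [/\ countable [set: Y], odd_involutive Y, dense_chain Y
         & fle_embedding h]) /\
  (forall (d : Order.disp_t) (X : fleChainType d),
     countable [set: X] -> odd_involutive X -> idempotent_symmetric X ->
     exists (d' : Order.disp_t) (Y : fleChainType d') (h : X -> Y),
       [/\ countable [set: Y], odd_involutive Y, dense_chain Y,
           idempotent_symmetric Y & fle_embedding h]).
Proof.
split=> [d X cX oddX|d X cX oddX symX]; exists _, (densification oddX), (@embed _ X).
  split; [exact: countable_densification | exact: odd_densification
    | exact: dense_densification | exact: embed_densification].
split; [exact: countable_densification | exact: odd_densification
  | exact: dense_densification | exact: idempotent_symmetric_densification
  | exact: embed_densification].
Qed.
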